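(* Let $\ell$ be a commutative unital ring, let $\{S_i:i\in I\}$ be a family of sets, $v_i\in S_i$ for each $i\in I$, and $S=\coprod_{i\in I}S_i$. Let $f=\bigoplus_{i\in I}\iota_{v_i}:\ell^{(I)}\to\bigoplus_{i\in I}M_{S_i}$, where $\iota_{v_i}:\ell\to M_{S_i}$, $\iota_{v_i}(a)=a\,\epsilon_{v_i,v_i}$. Let $T$ be an infinite set with $\#T\ge\#S$, and let $j:\mathrm{Alg}_\ell\to kk$ be the universal excisive, homotopy invariant and $M_T$-stable homology theory. Then $j(f)$ is an isomorphism.
   Context: $\mathrm{Alg}_\ell$ is the category of associative, not necessarily unital $\ell$-algebras. For a set $S$ and an algebra $A$, $M_SA$ is the algebra of finitely supported $S\times S$-matrices with entries in $A$, $M_S=M_S\ell$, and $\epsilon_{s,t}$ are the matrix units. $\ell^{(I)}=\bigoplus_{i\in I}\ell$ is the algebra of finitely supported functions $I\to\ell$. A homology theory is a functor $X:\mathrm{Alg}_\ell\to\mathcal T$ to a triangulated category $\mathcal T$ with inverse suspension $\Omega$. An extension is a short exact sequence of algebras $0\to A\to B\to C\to 0$ which splits $\ell$-linearly. $X$ is excisive if it comes equipped with maps $\partial:\Omega X(C)\to X(A)$, one for each extension, natural with respect to morphisms of extensions, such that $\Omega X(C)\to X(A)\to X(B)\to X(C)$ is a distinguished triangle. $X$ is homotopy invariant if it maps each inclusion $A\subset A[t]$ to an isomorphism. $X$ is $M_T$-stable if for every $A$ and $t\in T$ it maps $A\to M_TA$, $a\mapsto \epsilon_{t,t}\otimes a$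 to an isomorphism. For each infinite set $T$ there is a universal excisive, homotopy invariant, $M_T$-stable homology theory $j:\mathrm{Alg}_\ell\to kk$, i.e. an initial one, where morphisms $X\to Y$ are triangulated functors $G$ with $GX=Y$ compatible with the maps $\partial$. (Infinite direct sums are not assumed to exist in $kk$.) *)

(* Defs.v *)
From HB Require Import structures.
From mathcomp Require Import all_boot all_algebra finmap.
From mathcomp Require Import boolp classical_sets functions cardinality fsbigop.

Set Implicit Arguments.
Unset Strict Implicit.
Unset Printing Implicit Defensive.

Import GRing.Theory.
Local Open Scope ring_scope.
Local Open Scope classical_set_scope.

(* Associative, not necessarily unital algebras over R. *)
HB.mixin Record Lmodule_isNuAlgebra (R : comPzRingType) A of GRing.Lmodule R A := {
  numul : A -> A -> A;
  numulA : associative numul;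
  numulDl : left_distributive numul +%R;
  numulDr : right_distributive numul +%R;
  numulZl : forall (a : R) x y, numul (a *: x) y = a *: numul x y;
  numulZr : forall (a : R) x y, numul x (a *: y) = a *: numul x y
}.

#[short(type="nualgType")]
HB.structure Definition NuAlgebra (R : comPzRingType) :=
  {A of Lmodule_isNuAlgebra R A & GRing.Lmodule R A}.

Section NuAlgebraTheory.
Variables (R : comPzRingType) (A : nualgType R).
Implicit Types x y : A.

Lemma numul0l x : numul 0 x = 0.
Proof. by have := numulZl 0 0 x; rewrite !scale0r. Qed.

Lemma numul0r x : numul x 0 = 0.
Proof. by have := numulZr 0 x 0; rewrite !scale0r. Qed.

Lemma numul_suml (J : Type) (r : seq J) (P : pred J) (F : J -> A) y :
  numul (\sum_(i <- r | P i) F i) y = \sum_(i <- r | P i) numul (F i) y.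
Proof.
by rewrite (big_morph (numul^~ y) (fun a b => numulDl a b y) (numul0l y)).
Qed.

Lemma numul_sumr (J : Type) (r : seq J) (P : pred J) (F : J -> A) y :
  numul y (\sum_(i <- r | P i) F i) = \sum_(i <- r | P i) numul y (F i).
Proof. by rewrite (big_morph (numul y) (numulDr y) (numul0r y)). Qed.

End NuAlgebraTheory.

Section Regular.
Variable R : comPzRingType.

Let regulA : associative ( *%R : R^o -> R^o -> R^o).
Proof. exact: mulrA. Qed.
Let regulDl : left_distributive ( *%R : R^o -> R^o -> R^o) +%R.
Proof. exact: mulrDl. Qed.
Let regulDr : right_distributive ( *%R : R^o -> R^o -> R^o) +%R.
Proof. exact: mulrDr. Qed.
Let regulZl (a : R) (x y : R^o) : (a *: x) * y = a *: (x * y).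
Proof. exact: esym (mulrA a x y). Qed.
Let regulZr (a : R) (x y : R^o) : x * (a *: y) = a *: (x * y).
Proof. exact: mulrCA. Qed.

HB.instance Definition _ := Lmodule_isNuAlgebra.Build R R^o
  regulA regulDl regulDr regulZl regulZr.
End Regular.

(* Finitely supported families, with no multiplication: direct sums, matrix
   algebras and polynomial algebras are aliases of this module, each carrying
   its own product. *)
Section FinSupp.
Variables (R : comPzRingType) (I : Type) (A : I -> nualgType R).

Record finsupp := FinSupp {
  fsval :> forall i, A i;
  fsvalP : finite_set [set i | fsval i <> 0]
}.

HB.instance Definition _ := gen_eqMixin finsupp.
HB.instance Definition _ := gen_choiceMixin finsupp.

Implicit Types x y z : finsupp.

Lemma finsuppP x y : (forall i, x i = y i) -> x = y.
Proof.
case: x y => [f fP] [g gP] /= fg.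
have {fg} fg : f = g by exact: functional_extensionality_dep.
by case: _ / fg in gP *; congr FinSupp; exact: Prop_irrelevance.
Qed.

Lemma zero_fsP : finite_set [set i | (0 : A i) <> 0].
Proof.
by rewrite [X in finite_set X](_ : _ = set0)//; apply/seteqP; split.
Qed.

Lemma add_fsP x y : finite_set [set i | x i + y i <> 0].
Proof.
apply: (@sub_finite_set _ _ ([set i | x i <> 0] `|` [set i | y i <> 0])).
  move=> i /= xy0; case: (pselect (x i = 0)) => [xi0|]; last by left.
  by right=> yi0; apply: xy0; rewrite xi0 yi0 addr0.
by rewrite finite_setU; split; exact: fsvalP.
Qed.

Lemma opp_fsP x : finite_set [set i | - x i <> 0].
Proof.
by apply: sub_finite_set (fsvalP x) => i /= + x0; rewrite x0 oppr0.
Qed.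

Lemma scale_fsP (a : R) x : finite_set [set i | a *: x i <> 0].
Proof.
by apply: sub_finite_set (fsvalP x) => i /= + x0; rewrite x0 scaler0.
Qed.

Definition zero_fs := FinSupp zero_fsP.
Definition add_fs x y := FinSupp (add_fsP x y).
Definition opp_fs x := FinSupp (opp_fsP x).
Definition scale_fs a x := FinSupp (scale_fsP a x).

Let addA : associative add_fs.
Proof. by move=> x y z; apply: finsuppP => i /=; rewrite addrA. Qed.
Let addC : commutative add_fs.
Proof. by move=> x y; apply: finsuppP => i /=; rewrite addrC. Qed.
Let add0 : left_id zero_fs add_fs.
Proof. by move=> x; apply: finsuppP => i /=; rewrite add0r. Qed.
Let addN : left_inverse zero_fs opp_fs add_fs.
Proof. by move=> x; apply: finsuppP => i /=; rewrite addNr. Qed.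

HB.instance Definition _ := GRing.isZmodule.Build finsupp addA addC add0 addN.

Let scaleA (a b : R) x : scale_fs a (scale_fs b x) = scale_fs (a * b) x.
Proof. by apply: finsuppP => i /=; rewrite scalerA. Qed.
Let scale1 : left_id 1 scale_fs.
Proof. by move=> x; apply: finsuppP => i /=; rewrite scale1r. Qed.
Let scaleDr : right_distributive scale_fs +%R.
Proof. by move=> a x y; apply: finsuppP => i /=; rewrite scalerDr. Qed.
Let scaleDl x : {morph scale_fs^~ x : a b / a + b}.
Proof. by move=> a b; apply: finsuppP => i /=; rewrite scalerDl. Qed.

HB.instance Definition _ :=
  GRing.Zmodule_isLmodule.Build R finsupp scaleA scale1 scaleDr scaleDl.

Lemma fs0E i : (0 : finsupp) i = 0. Proof. by []. Qed.
Lemma fsDE x y i : (x + y) i = x i + y i. Proof. by []. Qed.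
Lemma fsNE x i : (- x) i = - x i. Proof. by []. Qed.
Lemma fsZE (a : R) x i : (a *: x) i = a *: x i. Proof. by []. Qed.

End FinSupp.

Section Single.
Variables (R : comPzRingType) (I : choiceType) (A : nualgType R).

Lemma single_fsP (k : I) (a : A) :
  finite_set [set i | (if i == k then a else 0) <> 0].
Proof.
by apply: (@sub_finite_set _ _ [set k]) => // i /=; case: eqP.
Qed.

Definition single (k : I) (a : A) : finsupp (fun _ : I => A) :=
  FinSupp (single_fsP k a).
End Single.

Section DirectSum.
Variables (R : comPzRingType) (I : Type) (A : I -> nualgType R).

Definition dirsum : Type := finsupp A.
HB.instance Definition _ := GRing.Lmodule.on dirsum.
Implicit Types x y z : dirsum.

Lemma dirsum_mulP x y : finite_set [set i | numul (x i) (y i) <> 0].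
Proof.
by apply: sub_finite_set (fsvalP x) => i /= + x0; rewrite x0 numul0l.
Qed.

Definition dirsum_mul x y : dirsum := FinSupp (dirsum_mulP x y).

Let mulA : associative dirsum_mul.
Proof. by move=> x y z; apply: finsuppP => i /=; rewrite numulA. Qed.
Let mulDl : left_distributive dirsum_mul +%R.
Proof. by move=> x y z; apply: finsuppP => i /=; rewrite numulDl. Qed.
Let mulDr : right_distributive dirsum_mul +%R.
Proof. by move=> x y z; apply: finsuppP => i /=; rewrite numulDr. Qed.
Let mulZl (a : R) x y : dirsum_mul (a *: x) y = a *: dirsum_mul x y.
Proof. by apply: finsuppP => i /=; rewrite numulZl. Qed.
Let mulZr (a : R) x y : dirsum_mul x (a *: y) = a *: dirsum_mul x y.
Proof. by apply: finsuppP => i /=; rewrite numulZr. Qed.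

HB.instance Definition _ := Lmodule_isNuAlgebra.Build R dirsum
  mulA mulDl mulDr mulZl mulZr.
End DirectSum.

Section MatrixAlgebra.
Variables (R : comPzRingType) (S : choiceType) (A : nualgType R).

(* M_S A; the entry at row s and column t of x is x (s, t), and
   single (s, t) a is the elementary matrix with entry a at (s, t). *)
Definition fmatrix : Type := finsupp (fun _ : S * S => A).
HB.instance Definition _ := GRing.Lmodule.on fmatrix.
Implicit Types x y z : fmatrix.

Let cols x : {fset S} := fset_set [set st.2 | st in [set st | x st <> 0]].

Let cols0 x s u : u \notin cols x -> x (s, u) = 0.
Proof.
apply: contraNP => xsu; rewrite /cols in_fset_set.
  by rewrite inE; exists (s, u).
exact/finite_image/fsvalP.
Qed.

(* The sum over all of S has finite support because x does. *)
Definition fmatrix_coef x y (st : S * S) : A :=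
  \sum_(u \in [set: S]) numul (x (st.1, u)) (y (u, st.2)).

Let coefE x y s t : fmatrix_coef x y (s, t) =
  \sum_(u <- cols x) numul (x (s, u)) (y (u, t)).
Proof. by rewrite /fmatrix_coef (fsbigTE (cols x))// => u /cols0->; rewrite numul0l. Qed.

Lemma fmatrix_mulP x y : finite_set [set st | fmatrix_coef x y st <> 0].
Proof.
apply: (@sub_finite_set _ _ ([set st.1 | st in [set st | x st <> 0]] `*`
                            [set st.2 | st in [set st | y st <> 0]])).
  move=> [s t] /=; rewrite coefE => xy0; apply: contrapT => h; apply: xy0.
  apply: big1_seq => u _.
  case: (pselect (x (s, u) = 0)) => [->|xsu]; first by rewrite numul0l.
  case: (pselect (y (u, t) = 0)) => [->|yut]; first by rewrite numul0r.
  by case: h; split; [exists (s, u)|exists (u, t)].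
by apply: finite_setX; exact/finite_image/fsvalP.
Qed.

Definition fmatrix_mul x y : fmatrix := FinSupp (fmatrix_mulP x y).

Let mulA : associative fmatrix_mul.
Proof.
move=> x y z; apply: finsuppP => -[s t] /=; rewrite coefE.
rewrite [RHS]/fmatrix_coef (fsbigTE (cols y)) => [|w yw]; last first.
  rewrite /= coefE big1_seq ?numul0l// => u _.
  by rewrite (cols0 _ yw) numul0r.
under [LHS]eq_bigr do rewrite /= coefE numul_sumr.
under [RHS]eq_bigr do rewrite /= coefE numul_suml.
rewrite exchange_big /=; apply: eq_bigr => w _; apply: eq_bigr => u _.
exact: numulA.
Qed.
Let mulDr : right_distributive fmatrix_mul +%R.
Proof.
move=> x y z; apply: finsuppP => -[s t]; rewrite fsDE /= !coefE -big_split.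
by apply: eq_bigr => u _; rewrite numulDr.
Qed.
Let mulDl : left_distributive fmatrix_mul +%R.
Proof.
move=> x y z; apply: finsuppP => -[s t]; rewrite fsDE /= /fmatrix_coef.
pose X := (cols x `|` cols y)%fset.
have X0 u v : u \notin X -> x (v, u) = 0 /\ y (v, u) = 0.
  by rewrite in_fsetU negb_or => /andP[/cols0-> /cols0->].
rewrite !(fsbigTE X) => [|u /X0 h|u /X0 h|u /X0 h].
- by rewrite -big_split; apply: eq_bigr => u _; rewrite /= numulDl.
- by rewrite (h s).2 numul0l.
- by rewrite (h s).1 numul0l.
- by rewrite /= (h s).1 (h s).2 addr0 numul0l.
Qed.
Let mulZl (a : R) x y : fmatrix_mul (a *: x) y = a *: fmatrix_mul x y.
Proof.
apply: finsuppP => -[s t]; rewrite fsZE /= [in RHS]coefE /fmatrix_coef scaler_sumr.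
rewrite (fsbigTE (cols x)) => [|u /cols0 x0]; last by rewrite fsZE x0 scaler0 numul0l.
by apply: eq_bigr => u _; rewrite fsZE numulZl.
Qed.
Let mulZr (a : R) x y : fmatrix_mul x (a *: y) = a *: fmatrix_mul x y.
Proof.
apply: finsuppP => -[s t]; rewrite fsZE /= !coefE scaler_sumr.
by apply: eq_bigr => u _; rewrite fsZE numulZr.
Qed.

HB.instance Definition _ := Lmodule_isNuAlgebra.Build R fmatrix
  mulA mulDl mulDr mulZl mulZr.
End MatrixAlgebra.

Section PolynomialAlgebra.
Variables (R : comPzRingType) (A : nualgType R).

(* A[t], an element being its sequence of coefficients ({poly A} would require
   A to be unital). *)
Definition nupoly : Type := finsupp (fun _ : nat => A).
HB.instance Definition _ := GRing.Lmodule.on nupoly.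
Implicit Types x y z : nupoly.

Definition nupoly_coef x y (n : nat) : A :=
  \sum_(i < n.+1) numul (x i) (y (n - i)%N).

Lemma nupoly_mulP x y : finite_set [set n | nupoly_coef x y n <> 0].
Proof.
apply: (@sub_finite_set _ _ [set (i + j)%N |
    i in [set i | x i <> 0] & j in [set j | y j <> 0]]).
  move=> n /= xy0; apply: contrapT => h; apply: xy0.
  apply: big1 => i _.
  case: (pselect (x i = 0)) => [->|xi]; first by rewrite numul0l.
  case: (pselect (y (n - i)%N = 0)) => [->|yi]; first by rewrite numul0r.
  by case: h; exists i => //; exists (n - i)%N => //; rewrite subnKC// -ltnS.
by apply: finite_image2; exact: fsvalP.
Qed.

Definition nupoly_mul x y : nupoly := FinSupp (nupoly_mulP x y).

Let coef_rev x y n :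
  nupoly_coef x y n = \sum_(i < n.+1) numul (x (n - i)%N) (y i).
Proof.
rewrite /nupoly_coef (reindex_inj rev_ord_inj) /=.
by apply: eq_bigr => i _; rewrite (sub_ordK i).
Qed.

Let mulA : associative nupoly_mul.
Proof.
move=> p q r; apply: finsuppP => i /=; rewrite [RHS]coef_rev {1}/nupoly_coef.
pose coef3 j k := numul (p j) (numul (q (i - j - k)%N) (r k)).
transitivity (\sum_(j < i.+1) \sum_(k < i.+1 | (k <= i - j)%N) coef3 j k).
  apply: eq_bigr => j _; rewrite /= coef_rev numul_sumr.
  by rewrite (big_ord_narrow_leq (leq_subr _ _)).
transitivity (\sum_(k < i.+1) \sum_(j < i.+1 | (j <= i - k)%N) coef3 j k).
  rewrite (exchange_big_dep predT) //=; apply: eq_bigr => k _; apply: eq_bigl => j.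
  have := ltn_ord j; have := ltn_ord k; rewrite !ltnS => ki ji.
  by rewrite !leq_subRL// addnC.
apply: eq_bigr => k _; rewrite /= /nupoly_coef numul_suml.
rewrite (big_ord_narrow_leq (leq_subr _ _)).
by apply: eq_bigr => j _; rewrite /coef3 numulA /= subnAC.
Qed.
Let mulDl : left_distributive nupoly_mul +%R.
Proof.
move=> x y z; apply: finsuppP => n; rewrite fsDE /= -big_split.
by apply: eq_bigr => i _; rewrite fsDE numulDl.
Qed.
Let mulDr : right_distributive nupoly_mul +%R.
Proof.
move=> x y z; apply: finsuppP => n; rewrite fsDE /= -big_split.
by apply: eq_bigr => i _; rewrite fsDE numulDr.
Qed.
Let mulZl (a : R) x y : nupoly_mul (a *: x) y = a *: nupoly_mul x y.
Proof.
apply: finsuppP => n; rewrite fsZE /= scaler_sumr.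
by apply: eq_bigr => i _; rewrite fsZE numulZl.
Qed.
Let mulZr (a : R) x y : nupoly_mul x (a *: y) = a *: nupoly_mul x y.
Proof.
apply: finsuppP => n; rewrite fsZE /= scaler_sumr.
by apply: eq_bigr => i _; rewrite fsZE numulZr.
Qed.

HB.instance Definition _ := Lmodule_isNuAlgebra.Build R nupoly
  mulA mulDl mulDr mulZl mulZr.
End PolynomialAlgebra.

Section NuHom.
Variable R : comPzRingType.

Record nuhom (A B : nualgType R) := NuHom {
  nuhom_fun :> A -> B;
  nuhom_linear : linear nuhom_fun;
  nuhomM : {morph nuhom_fun : x y / numul x y}
}.

HB.instance Definition _ (A B : nualgType R) (f : nuhom A B) :=
  GRing.isLinear.Build R A B _ (nuhom_fun f) (nuhom_linear f).

Lemma nuhomP (A B : nualgType R) (f g : nuhom A B) : f =1 g -> f = g.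
Proof.
case: f g => [f fl fM] [g gl gM] /= /funext fg.
by case: _ / fg in gl gM *; congr NuHom; exact: Prop_irrelevance.
Qed.

Definition nuhom_id (A : nualgType R) : nuhom A A :=
  @NuHom A A id (fun _ _ _ => erefl) (fun _ _ => erefl).

Lemma nuhom_comp_linear (A B C : nualgType R) (g : nuhom B C) (f : nuhom A B) :
  linear (g \o f).
Proof. by move=> a x y; rewrite /= !linearP. Qed.

Lemma nuhom_compM (A B C : nualgType R) (g : nuhom B C) (f : nuhom A B) :
  {morph g \o f : x y / numul x y}.
Proof. by move=> x y; rewrite /= !nuhomM. Qed.

Definition nuhom_comp (A B C : nualgType R) (g : nuhom B C) (f : nuhom A B) :
  nuhom A C := NuHom (nuhom_comp_linear g f) (nuhom_compM g f).

End NuHom.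

Section Corner.
Variables (R : comPzRingType) (S : choiceType) (A : nualgType R) (s : S).

Let corner_fun (a : A) : fmatrix S A := single (s, s) a.

Lemma corner_linear : linear corner_fun.
Proof.
move=> a x y; apply: finsuppP => st /=.
by case: eqP => // _; rewrite scaler0 addr0.
Qed.

Lemma cornerM : {morph corner_fun : x y / numul x y}.
Proof.
move=> x y; apply: finsuppP => -[i k].
rewrite /= /fmatrix_coef (fsbigTE [fset s]%fset) /=; last first.
  by move=> u; rewrite in_fset1 !xpair_eqE => /negbTE->; rewrite andbF numul0l.
rewrite big_seq_fset1 !xpair_eqE eqxx andbT /=.
by case: (i == s); case: (k == s); rewrite ?numul0l ?numul0r.
Qed.

Definition corner : nuhom A (fmatrix S A) := NuHom corner_linear cornerM.
End Corner.

Section ConstantPolynomials.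
Variables (R : comPzRingType) (A : nualgType R).

Let nupolyC_fun (a : A) : nupoly A := single 0%N a.

Lemma nupolyC_linear : linear nupolyC_fun.
Proof.
move=> a x y; apply: finsuppP => n /=.
by case: eqP => // _; rewrite scaler0 addr0.
Qed.

Lemma nupolyCM : {morph nupolyC_fun : x y / numul x y}.
Proof.
move=> x y; apply: finsuppP => n; rewrite /= /nupoly_coef big_ord_recl /=.
rewrite subn0 big1 => [|i _]; last by rewrite numul0l.
by rewrite addr0; case: (n == 0%N); rewrite ?numul0r.
Qed.

Definition nupolyC : nuhom A (nupoly A) := NuHom nupolyC_linear nupolyCM.
End ConstantPolynomials.

Section DirectSumMap.
Variables (R : comPzRingType) (I : Type) (A B : I -> nualgType R).
Variable f : forall i, nuhom (A i) (B i).

Lemma dirsum_mapP (x : dirsum A) : finite_set [set i | f i (x i) <> 0].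
Proof.
by apply: sub_finite_set (fsvalP x) => i /= + x0; rewrite x0 linear0.
Qed.

Let dirsum_map_fun (x : dirsum A) : dirsum B := FinSupp (dirsum_mapP x).

Lemma dirsum_map_linear : linear dirsum_map_fun.
Proof. by move=> a x y; apply: finsuppP => i /=; rewrite linearP. Qed.

Lemma dirsum_mapM : {morph dirsum_map_fun : x y / numul x y}.
Proof. by move=> x y; apply: finsuppP => i /=; rewrite nuhomM. Qed.

Definition dirsum_map : nuhom (dirsum A) (dirsum B) :=
  NuHom dirsum_map_linear dirsum_mapM.
End DirectSumMap.

(* Short exact sequences that split R-linearly; the splitting is not part of
   the structure. *)
Record extension (R : comPzRingType) := Extension {
  ext_sub : nualgType R;
  ext_mid : nualgType R;
  ext_quo : nualgType R;
  ext_inc : nuhom ext_sub ext_mid;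
  ext_prj : nuhom ext_mid ext_quo;
  ext_inj : injective ext_inc;
  ext_exact : forall b, ext_prj b = 0 <-> exists a, ext_inc a = b;
  ext_surj : forall c, exists b, ext_prj b = c;
  ext_split : exists s : {linear ext_quo -> ext_mid}, cancel s ext_prj
}.

Record extension_map (R : comPzRingType) (E E' : extension R) := ExtensionMap {
  extm_sub : nuhom (ext_sub E) (ext_sub E');
  extm_mid : nuhom (ext_mid E) (ext_mid E');
  extm_quo : nuhom (ext_quo E) (ext_quo E');
  extm_inc : forall a, extm_mid (ext_inc E a) = ext_inc E' (extm_sub a);
  extm_prj : forall b, extm_quo (ext_prj E b) = ext_prj E' (extm_mid b)
}.

Declare Scope cat_scope.
Delimit Scope cat_scope with cat.
Local Open Scope cat_scope.

Record category := Category {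
  ob :> Type;
  hom : ob -> ob -> Type;
  idc : forall x, hom x x;
  comp : forall x y z, hom y z -> hom x y -> hom x z;
  compA : forall x y z t (h : hom z t) (g : hom y z) (f : hom x y),
    comp h (comp g f) = comp (comp h g) f;
  comp1c : forall x y (f : hom x y), comp (idc y) f = f;
  compc1 : forall x y (f : hom x y), comp f (idc x) = f
}.
Arguments hom {c} x y.
Arguments idc {c} x.
Arguments comp {c x y z} g f.
Notation "g ∘ f" := (comp g f) (at level 40, left associativity) : cat_scope.

Definition is_iso (C : category) (x y : C) (f : hom x y) :=
  exists g : hom y x, g ∘ f = idc x /\ f ∘ g = idc y.

Record functor (C D : category) := Functor {
  fob :> C -> D;
  fmor : forall x y, hom x y -> hom (fob x) (fob y);
  fmor1 : forall x, fmor (idc x) = idc (fob x);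
  fmorM : forall x y z (g : hom y z) (f : hom x y),
    fmor (g ∘ f) = fmor g ∘ fmor f
}.
Arguments fmor {C D} F {x y} f : rename.

Definition functor_id (C : category) : functor C C :=
  @Functor C C id (fun _ _ f => f) (fun _ => erefl) (fun _ _ _ _ _ => erefl).

Section FunctorComp.
Variables (C D E : category) (G : functor D E) (F : functor C D).

Lemma functor_comp1 x : fmor G (fmor F (idc x)) = idc (G (F x)).
Proof. by rewrite !fmor1. Qed.

Lemma functor_compM x y z (g : hom y z) (f : hom x y) :
  fmor G (fmor F (g ∘ f)) = fmor G (fmor F g) ∘ fmor G (fmor F f).
Proof. by rewrite !fmorM. Qed.

Definition functor_comp : functor C E := Functor functor_comp1 functor_compM.
End FunctorComp.

Definition is_nat_iso (C D : category) (F G : functor C D)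
    (eta : forall x, hom (F x) (G x)) :=
  (forall x, is_iso (eta x)) /\
  (forall x y (f : hom x y), eta y ∘ fmor F f = fmor G f ∘ eta x).

Definition is_equivalence (C D : category) (F : functor C D) :=
  exists G : functor D C,
    (exists eta, @is_nat_iso C C (functor_comp G F) (functor_id C) eta) /\
    (exists eps, @is_nat_iso D D (functor_comp F G) (functor_id D) eps).

(* Additive categories: hom-groups with bilinear composition, a zero object
   (one whose identity is the zero map) and binary biproducts. *)
Record addcat := AddCat {
  aob : Type;
  ahom : aob -> aob -> zmodType;
  aid : forall x, ahom x x;
  acomp : forall x y z, ahom y z -> ahom x y -> ahom x z;
  acompA : forall x y z t (h : ahom z t) (g : ahom y z) (f : ahom x y),
    acomp h (acomp g f) = acomp (acomp h g) f;
  acomp1c : forall x y (f : ahom x y), acomp (aid y) f = f;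
  acompc1 : forall x y (f : ahom x y), acomp f (aid x) = f;
  acompDl : forall x y z (g g' : ahom y z) (f : ahom x y),
    acomp (g + g') f = acomp g f + acomp g' f;
  acompDr : forall x y z (g : ahom y z) (f f' : ahom x y),
    acomp g (f + f') = acomp g f + acomp g f';
  azero : exists z, aid z = 0;
  abiprod : forall x y, exists p
    (ix : ahom x p) (iy : ahom y p) (px : ahom p x) (py : ahom p y),
    [/\ acomp px ix = aid x, acomp py iy = aid y, acomp px iy = 0,
        acomp py ix = 0 & acomp ix px + acomp iy py = aid p]
}.

Definition cat_of_addcat (C : addcat) : category :=
  Category (@acompA C) (@acomp1c C) (@acompc1 C).
Coercion cat_of_addcat : addcat >-> category.

Definition is_additive (C D : addcat) (F : functor C D) :=
  forall (x y : C) (f g : ahom x y),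
    fmor F (f + g : ahom x y) = (fmor F f : ahom (F x) (F y)) + fmor F g.

(* Triangulated categories presented by the inverse suspension Omega, an
   additive self-equivalence which need not be invertible on the nose.
   A triangle is a sequence
     Omega c --d--> a --f--> b --g--> c
   and the axioms are the usual ones (TR1-TR4), read in the opposite category
   with Omega as its shift. *)
Record tricat := TriCat {
  tcat :> addcat;
  Omega : functor tcat tcat;
  Omega_additive : is_additive Omega;
  Omega_equiv : is_equivalence Omega;
  dist : forall a b c : tcat,
    hom (Omega c) a -> hom a b -> hom b c -> Prop;
  dist_iso : forall (a b c a' b' c' : tcat)
      (d : hom (Omega c) a) (f : hom a b) (g : hom b c)
      (d' : hom (Omega c') a') (f' : hom a' b') (g' : hom b' c')
      (u : hom a a') (v : hom b b') (w : hom c c'),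
    is_iso u -> is_iso v -> is_iso w ->
    u ∘ d = d' ∘ fmor Omega w -> v ∘ f = f' ∘ u -> w ∘ g = g' ∘ v ->
    dist d f g -> dist d' f' g';
  dist_id : forall z c : tcat, idc z = 0 :> ahom z z ->
    dist (0 : ahom (Omega c) z) (0 : ahom z c) (idc c);
  dist_ex : forall (b c : tcat) (g : hom b c),
    exists a (d : hom (Omega c) a) (f : hom a b), dist d f g;
  dist_rot : forall (a b c : tcat)
      (d : hom (Omega c) a) (f : hom a b) (g : hom b c),
    dist d f g <-> dist (- (fmor Omega g : ahom (Omega b) (Omega c))) d f;
  dist_map : forall (a b c a' b' c' : tcat)
      (d : hom (Omega c) a) (f : hom a b) (g : hom b c)
      (d' : hom (Omega c') a') (f' : hom a' b') (g' : hom b' c')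
      (v : hom b b') (w : hom c c'),
    dist d f g -> dist d' f' g' -> w ∘ g = g' ∘ v ->
    exists u : hom a a', u ∘ d = d' ∘ fmor Omega w /\ v ∘ f = f' ∘ u;
  dist_oct : forall (x y z x' y' z' : tcat)
      (u : hom y x) (v : hom z y)
      (k : hom (Omega x) z') (j : hom z' y)
      (i : hom (Omega y) x') (l : hom x' z)
      (n : hom (Omega x) y') (m : hom y' z),
    dist k j u -> dist i l v -> dist n m (u ∘ v) ->
    exists (f : hom y' z') (g : hom x' y'),
      [/\ dist (i ∘ fmor Omega j) g f, j ∘ f = v ∘ m, f ∘ n = k,
          m ∘ g = l & g ∘ i = n ∘ fmor Omega u]
}.
Arguments Omega {t}.
Arguments dist {t a b c} d f g.

(* The comparison isomorphism between Omega G and G Omega is part of the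
   data of a triangulated functor G. *)
Record trifunctor (C D : tricat) := TriFunctor {
  tfun :> functor C D;
  tfun_additive : is_additive tfun;
  tfun_Omega : forall c : C, hom (Omega (tfun c)) (tfun (Omega c));
  tfun_OmegaP : @is_nat_iso C D
    (functor_comp Omega tfun) (functor_comp tfun Omega) tfun_Omega;
  tfun_dist : forall (a b c : C)
      (d : hom (Omega c) a) (f : hom a b) (g : hom b c),
    dist d f g -> dist (fmor tfun d ∘ tfun_Omega c) (fmor tfun f) (fmor tfun g)
}.

Definition Alg (R : comPzRingType) : category.
Proof.
refine (@Category (nualgType R) (@nuhom R) (@nuhom_id R) (@nuhom_comp R) _ _ _);
  by move=> *; apply: nuhomP.
Defined.

Section HomologyTheories.
Variable R : comPzRingType.

(* A functor together with candidate connecting maps; whether these satisfy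
   the conditions on them is the predicate excisive. *)
Record homology_theory (D : tricat) := HomologyTheory {
  theory :> functor (Alg R) D;
  boundary : forall E : extension R,
    hom (Omega (theory (ext_quo E))) (theory (ext_sub E))
}.

Definition excisive (D : tricat) (X : homology_theory D) :=
  (forall (E E' : extension R) (m : extension_map E E'),
     fmor X (extm_sub m) ∘ boundary X E =
     boundary X E' ∘ fmor Omega (fmor X (extm_quo m))) /\
  (forall E : extension R,
     dist (boundary X E) (fmor X (ext_inc E)) (fmor X (ext_prj E))).

Definition homotopy_invariant (D : tricat) (X : functor (Alg R) D) :=
  forall A : nualgType R, is_iso (fmor X (nupolyC A)).

Definition matrix_stable (T : choiceType) (D : tricat)
    (X : functor (Alg R) D) :=
  forall (A : nualgType R) (t : T), is_iso (fmor X (corner A t)).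

(* The theory G X, with connecting maps
     Omega G X(C) ~ G Omega X(C) --> G X(A).
   The equation push_theory G X = Y thus says both that G X = Y as functors
   and that G is compatible with the connecting maps. *)
Definition push_theory (C D : tricat) (G : trifunctor C D)
    (X : homology_theory C) : homology_theory D :=
  @HomologyTheory D (functor_comp G X)
    (fun E => fmor G (boundary X E) ∘ tfun_Omega G (X (ext_quo E))).

Definition admissible (T : choiceType) (D : tricat) (X : homology_theory D) :=
  [/\ excisive X, homotopy_invariant X & matrix_stable T X].

Definition universal_theory (T : choiceType) (kk : tricat)
    (j : homology_theory kk) :=
  admissible T j /\
  forall (D : tricat) (Y : homology_theory D), admissible T Y ->
    exists! G : trifunctor kk D, push_theory G j = Y.

End HomologyTheories.

(* Main.v *)
(* Write A = l^(I), A' the direct sum of copies of M_1 l, so that f factors as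
   A ~ A' -> B with B the direct sum of the M_{S_i}. Choose t0 in T and an
   injection tau of S into T missing t0. The entries tau s give a map
   g : B -> M_T A'. Both g f (up to A ~ A') and M_T(A' -> B) g are of the form
   x |-> u x w for infinite matrices u, w with w u = 1, while
   the corner inclusions at t0 are of the form x |-> u' x w' with w' u' = 1 and
   w u' = w' u = 0. Such maps are polynomially homotopic through
   (p1 u' + p2 u) x (q1 w' + q2 w), where p1 q1 + p2 q2 = 1. Hence g has a
   left and a right inverse up to isomorphism in kk, and so f is invertible. *)
From mathcomp Require Import finmap.
From mathcomp Require Import all_boot all_algebra.
From mathcomp Require Import boolp classical_sets functions cardinality fsbigop.
From mathcomp Require Import ring.
Require Import Defs.

Set Implicit Arguments.
Unset Strict Implicit.
Unset Printing Implicit Defensive.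

Import GRing.Theory.
Local Open Scope ring_scope.
Local Open Scope classical_set_scope.
Local Open Scope card_scope.
Local Open Scope cat_scope.

Lemma nuhomD (R : comPzRingType) (A B : nualgType R) (f : nuhom A B) x y :
  f (x + y) = f x + f y.
Proof. exact: linearD. Qed.

(** * Evaluation of polynomials at 0 and at 1 *)

Section Evaluation.
Variables (R : comPzRingType) (A : nualgType R).
Implicit Types x y : nupoly A.

Lemma nupoly_bounded x : exists N, forall n, (N <= n)%N -> x n = 0.
Proof.
exists (\max_(i <- fset_set [set n | x n <> 0]) i).+1 => n.
apply: contraPP => xn0; apply/negP; rewrite -ltnNge ltnS.
apply: (leq_bigmax_seq (F := id)) => //.
by rewrite (in_fset_set (fsvalP x)) inE.
Qed.

Definition ev1_fun x : A := \sum_(n \in [set: nat]) x n.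

Lemma ev1E x N : (forall n, (N <= n)%N -> x n = 0) -> ev1_fun x = \sum_(n < N) x n.
Proof.
move=> xN; rewrite fsbig_ord; apply/esym/fsbig_widen => // n [_ /= /negP].
by rewrite -leqNgt; exact: xN.
Qed.

Lemma ev1_linear : linear ev1_fun.
Proof.
move=> a x y; have [N xN] := nupoly_bounded x; have [M yM] := nupoly_bounded y.
rewrite !(@ev1E _ (N + M)) => [|n NMn|n NMn|n NMn].
- by rewrite scaler_sumr -big_split.
- by rewrite yM// (leq_trans _ NMn) ?leq_addl.
- by rewrite xN// (leq_trans _ NMn) ?leq_addr.
- rewrite fsDE fsZE xN ?yM ?scaler0 ?addr0//.
    by rewrite (leq_trans _ NMn) ?leq_addl.
  by rewrite (leq_trans _ NMn) ?leq_addr.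
Qed.

(** Summing the Cauchy product over all degrees [n < N + M] gives a double sum over [i <= n];
    exchanging the sums and shifting [n] by [i] separates the two factors. *)
Lemma ev1M : {morph ev1_fun : x y / numul x y}.
Proof.
move=> x y; have [N xN] := nupoly_bounded x; have [M yM] := nupoly_bounded y.
rewrite (ev1E xN) (ev1E yM) (@ev1E _ (N + M)) => [|n NMn]; last first.
  rewrite /= /nupoly_coef big1// => i _; case: (leqP N i) => [/xN->|iN].
    by rewrite numul0l.
  rewrite yM ?numul0r// leq_subRL ?(leq_trans _ NMn) ?leq_add2r ?(ltnW iN)//.
  by rewrite (leq_trans (ltnW iN)) ?leq_addr.
rewrite (numul_suml (index_enum _) xpredT (fun n : ordinal N => x n)).
transitivity (\sum_(0 <= n < N + M) \sum_(0 <= i < N + M | (i < n.+1)%N)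
    numul (x i) (y (n - i)%N)).
  rewrite big_mkord; apply: eq_bigr => n _.
  by rewrite -(big_nat_widen _ _ _ predT)// big_mkord.
rewrite (exchange_big_dep_nat predT)//= big_mkord big_split_ord/=.
rewrite [X in _ + X]big1 ?addr0 => [|i _]; last first.
  by apply: big1 => n _; rewrite xN ?leq_addr// numul0l.
apply: eq_bigr => i _; rewrite numul_sumr -(big_mkord xpredT (fun n => numul (x i) (y n))).
have -> : forall F : nat -> A, \sum_(0 <= n < N + M | (i < n.+1)%N) F n =
    \sum_(0 <= n < N + M - i) F (n + i)%N.
  by move=> F; rewrite -(big_addn 0 _ i predT) add0n [RHS](big_nat_widenl i 0).
(* The shifted range contains all degrees below [M]; beyond them [y] vanishes. *)
have MiNM : (M <= N + M - i)%N by rewrite addnC -addnBA ?leq_addr// ltnW.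
rewrite (big_cat_nat (leq0n M) MiNM)//=.
rewrite [X in _ + X]big_nat_cond [X in _ + X]big1 ?addr0 => [|n].
  by apply: eq_bigr => n _; rewrite addnK.
by case/andP => /andP[Mn _] _; rewrite addnK yM// numul0r.
Qed.

Definition ev1 : nuhom (nupoly A) A := NuHom ev1_linear ev1M.

Lemma ev0_linear : linear (fun x : nupoly A => x 0%N).
Proof. by []. Qed.

Lemma ev0M : {morph (fun x : nupoly A => x 0%N) : x y / numul x y}.
Proof. by move=> x y; rewrite /= /nupoly_coef big_ord1 subn0. Qed.

Definition ev0 : nuhom (nupoly A) A := NuHom ev0_linear ev0M.

Lemma ev0C : nuhom_comp ev0 (nupolyC A) = nuhom_id A.
Proof. exact: nuhomP. Qed.

Lemma ev1C : nuhom_comp ev1 (nupolyC A) = nuhom_id A.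
Proof.
apply: nuhomP => a; rewrite /= (@ev1E _ 1%N) => [|[]//].
by rewrite big_ord1.
Qed.

(* Both evaluations are left inverses of the isomorphism X(A -> A[t]). *)
Lemma homotopy_invariant_ev (D : tricat) (X : functor (Alg R) D) :
  homotopy_invariant X -> fmor X (ev0 : @hom (Alg R) _ _) = fmor X (ev1 : @hom (Alg R) _ _).
Proof.
move=> /(_ A)[g [_ gK]].
have E (e : @hom (Alg R) (nupoly A) A) : nuhom_comp e (nupolyC A) = nuhom_id A -> fmor X e = g.
  move=> eC; rewrite -[LHS]compc1 -gK compA -fmorM.
  by rewrite [X in fmor _ X](eC : e ∘ _ = idc _) fmor1 comp1c.
by rewrite !E ?ev0C ?ev1C.
Qed.

End Evaluation.

(** * Multiples of algebra elements by integer polynomials *)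

Section PolynomialMultiples.
Variables (R : comPzRingType) (A : nualgType R).
Implicit Types (p q : {poly int}) (a b : A).

Lemma polyscale_subproof p a : finite_set [set n | (p`_n)%:~R *: a <> 0].
Proof.
apply: (sub_finite_set _ (finite_II (size p))) => n /=.
by apply: contra_notT; rewrite -leqNgt => /(nth_default 0)->; rewrite scale0r.
Qed.

(** The element p(t) a of A[t]. As A need not contain 1, p is kept outside A; integer coefficients
    serve every base ring at once. *)
Definition polyscale p a : nupoly A := FinSupp (polyscale_subproof p a).

Lemma polyscale_linear p : linear (polyscale p).
Proof.
by move=> c a b; apply: finsuppP => n /=; rewrite scalerDr !scalerA mulrC.
Qed.

Lemma polyscaleDl p q a : polyscale (p + q) a = polyscale p a + polyscale q a.
Proof. by apply: finsuppP => n /=; rewrite coefD intrD scalerDl. Qed.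

Lemma polyscale_suml (J : Type) (r : seq J) (F : J -> {poly int}) a :
  polyscale (\sum_(i <- r) F i) a = \sum_(i <- r) polyscale (F i) a.
Proof.
apply: (big_morph (polyscale^~ a)) => [p q|]; first exact: polyscaleDl.
by apply: finsuppP => n /=; rewrite coef0 scale0r.
Qed.

Lemma polyscaleM p q a b :
  numul (polyscale p a) (polyscale q b) = polyscale (p * q) (numul a b).
Proof.
apply: finsuppP => n /=; rewrite /nupoly_coef coefM rmorph_sum scaler_suml.
by apply: eq_bigr => i _; rewrite /= numulZl numulZr scalerA intrM.
Qed.

Lemma ev0_polyscale p a : ev0 A (polyscale p a) = (p.[0])%:~R *: a.
Proof. by rewrite /= horner_coef0. Qed.

Lemma ev1_polyscale p a : ev1 A (polyscale p a) = (p.[1])%:~R *: a.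
Proof.
rewrite /= (@ev1E _ _ _ (size p)) => [|n /(nth_default 0) pn]; last by rewrite /= pn scale0r.
rewrite horner_coef rmorph_sum scaler_suml.
by apply: eq_bigr => i _; rewrite /= expr1n mulr1.
Qed.

End PolynomialMultiples.

(** * Rotation homotopies *)

Section Rotation.
Variables (R : comPzRingType) (A B : nualgType R).
(** Abstract form of [phi j k x] = u_j x w_k, where w_k u_m is 1 if k = m and 0 otherwise; neither
    u_j nor w_k has to lie in B. *)
Variable phi : bool -> bool -> A -> B.
Hypothesis phi_linear : forall j k, linear (phi j k).
Hypothesis phiM : forall j k m n x y,
  numul (phi j k x) (phi m n y) = if k == m then phi j n (numul x y) else 0.

Lemma phi_diagM j : {morph phi j j : x y / numul x y}.
Proof. by move=> x y; rewrite phiM eqxx. Qed.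

Definition phi_diag j : nuhom A B := NuHom (phi_linear j j) (phi_diagM j).

(* (1 - t, t) and ((1 - t) (1 + 2 t), t (3 - 2 t)): a column and a row of product
   1, both equal to e_1 at t = 0 and to e_2 at t = 1; index false is the first
   coordinate. *)
Definition rot_col (j : bool) : {poly int} := if j then 'X else 1 - 'X.
Definition rot_row (j : bool) : {poly int} :=
  if j then 'X * (3%:R - 2%:R * 'X) else (1 - 'X) * (1 + 2%:R * 'X).

(** The two summands are 1 - 3 t^2 + 2 t^3 and 3 t^2 - 2 t^3. *)
Lemma rot_rowcol : \sum_j rot_row j * rot_col j = 1.
Proof. rewrite big_bool /=; ring. Qed.

Lemma rot0 j k : (rot_col j * rot_row k).[0] = (~~ j && ~~ k)%:R.
Proof. by case: j; case: k; rewrite /= !hornerE. Qed.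

Lemma rot1 j k : (rot_col j * rot_row k).[1] = (j && k)%:R.
Proof. by case: j; case: k; rewrite /= !hornerE. Qed.

(** Formally U x W, where U is the sum of the [rot_col j] u_j and W that of the [rot_row k] w_k;
    thus W U = 1. *)
Definition rotation_fun (x : A) : nupoly B :=
  \sum_j \sum_k polyscale (rot_col j * rot_row k) (phi j k x).

Lemma rotation_linear : linear rotation_fun.
Proof.
move=> a x y; rewrite /rotation_fun scaler_sumr -big_split; apply: eq_bigr => j _.
rewrite scaler_sumr -big_split; apply: eq_bigr => k _.
by rewrite phi_linear polyscale_linear.
Qed.

Lemma rotationM : {morph rotation_fun : x y / numul x y}.
Proof.
move=> x y; rewrite /rotation_fun [RHS]numul_suml; apply: eq_bigr => j _.
rewrite [RHS]numul_suml.
(* The factor 1 = [\sum_k rot_row k * rot_col k] is inserted in the middle: these are the terms of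
   the product whose inner indices agree. *)
transitivity (\sum_k \sum_n
    polyscale (rot_col j * rot_row k * (rot_col k * rot_row n)) (phi j n (numul x y))).
  rewrite exchange_big; apply: eq_bigr => n _; rewrite -polyscale_suml; congr polyscale.
  rewrite -[LHS]mulr1 -rot_rowcol mulr_sumr; apply: eq_bigr => k _; ring.
apply: eq_bigr => k _; rewrite [RHS]numul_sumr [RHS](bigD1 k)//=.
rewrite [X in _ + X]big1 ?addr0 => [|m mk].
  by rewrite numul_sumr; apply: eq_bigr => n _; rewrite polyscaleM phiM eqxx.
rewrite numul_sumr big1// => n _; rewrite polyscaleM phiM eq_sym (negbTE mk).
by apply: finsuppP => i /=; rewrite scaler0.
Qed.

Definition rotation : nuhom A (nupoly B) := NuHom rotation_linear rotationM.

(** At t = 0 only the coefficient with [j = k = false] survives, at t = 1 only the one with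
    [j = k = true], so [rotation] joins the two diagonal maps. *)
Lemma homotopy_invariant_phi_diag (D : tricat) (X : functor (Alg R) D) :
  homotopy_invariant X ->
  fmor X (phi_diag false : @hom (Alg R) _ _) = fmor X (phi_diag true : @hom (Alg R) _ _).
Proof.
move=> Xh.
have <- : nuhom_comp (ev0 B) rotation = phi_diag false.
  apply: nuhomP => x; rewrite [LHS]/= -[LHS]/(ev0 B (rotation_fun x)) /rotation_fun.
  rewrite !big_bool !nuhomD !ev0_polyscale !rot0.
  by rewrite /= !scale0r !add0r scale1r.
have <- : nuhom_comp (ev1 B) rotation = phi_diag true.
  apply: nuhomP => x; rewrite [LHS]/= -[LHS]/(ev1 B (rotation_fun x)) /rotation_fun.
  rewrite !big_bool !nuhomD !ev1_polyscale !rot1.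
  by rewrite /= !scale0r !addr0 scale1r.
by rewrite [LHS](fmorM X) [RHS](fmorM X) (homotopy_invariant_ev _ Xh).
Qed.
End Rotation.

(** * Partial inverses of injections, and finite forms of the matrix product *)

Definition partial_inv (X Y : Type) (f : X -> Y) (y : Y) : option X :=
  if pselect (exists x, f x = y) is left h then Some (projT1 (cid h)) else None.

Lemma partial_invK (X Y : Type) (f : X -> Y) :
  injective f -> pcancel f (partial_inv f).
Proof.
move=> f_inj x; rewrite /partial_inv; case: pselect => [h|[]]; last by exists x.
by congr Some; apply: f_inj; exact: (projT2 (cid h)).
Qed.

Lemma partial_inv_some (X Y : Type) (f : X -> Y) x y :
  partial_inv f y = Some x -> f x = y.
Proof.
rewrite /partial_inv; case: pselect => // h [<-]; exact: (projT2 (cid h)).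
Qed.

Section MatrixProduct.
Variables (R : comPzRingType) (S : choiceType) (A : nualgType R).
Implicit Types x y : fmatrix S A.

Lemma fmatrix_cols x : exists U : {fset S}, forall s u, u \notin U -> x (s, u) = 0.
Proof.
exists (fset_set [set st.2 | st in [set st | x st <> 0]]) => s u.
apply: contraNP => xsu; rewrite in_fset_set; last exact/finite_image/fsvalP.
by rewrite inE; exists (s, u).
Qed.

Lemma fmatrix_mulE x y s t (U : {fset S}) :
  (forall u, u \notin U -> x (s, u) = 0) ->
  numul x y (s, t) = \sum_(u <- U) numul (x (s, u)) (y (u, t)).
Proof.
by move=> xU; rewrite [LHS](fsbigTE U)//= => u /xU->; rewrite numul0l.
Qed.
End MatrixProduct.

Lemma fs_sumE (R : comPzRingType) (I J : Type) (A : I -> nualgType R) (r : seq J)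
    (F : J -> finsupp A) i :
  (\sum_(j <- r) F j) i = \sum_(j <- r) F j i.
Proof. exact: (big_morph (fun x : finsupp A => x i)). Qed.

(** * Block maps x |-> u x v^T into [T]-matrices over a direct sum *)

Section BlockMap.
Variables (R : comPzRingType) (C : nualgType R) (I : Type) (T : choiceType).
Variables (S S' : I -> choiceType).
Implicit Types (i : I) (s t : T) (a b c d : forall i, S i -> T * S' i).
Implicit Types x y : dirsum (fun i => fmatrix (S i) C).

(* The entry at (z, w) of u x v^T, where u and v are the 0-1 matrices with
   1s at (a i k, k) and (b i m, m) in the block i. *)
Definition block_entry a b x (i : I) (z w : T * S' i) : C :=
  if partial_inv (a i) z is Some k then
    if partial_inv (b i) w is Some m then x i (k, m) else 0
  else 0.

Arguments block_entry : clear implicits.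

Lemma block_entryE a b x i k m : injective (a i) -> injective (b i) ->
  block_entry a b x i (a i k) (b i m) = x i (k, m).
Proof. by move=> ai bi; rewrite /block_entry !partial_invK. Qed.

Lemma block_entry_neq0 a b x i z w : block_entry a b x i z w <> 0 ->
  exists k m, [/\ a i k = z, b i m = w & x i (k, m) <> 0].
Proof.
rewrite /block_entry; case E: partial_inv => [k|//]; case F: partial_inv => [m|//] x0.
by exists k, m; split=> //; exact: partial_inv_some.
Qed.

Lemma block_entry_eq0 a b x i z w :
  (forall k m, a i k = z -> b i m = w -> x i (k, m) = 0) ->
  block_entry a b x i z w = 0.
Proof. by move=> h; apply: contrapT => /block_entry_neq0[k [m [az bw]]]; apply; exact: h. Qed.

Lemma block_entry0l a b x i z w :
  (forall k, a i k <> z) -> block_entry a b x i z w = 0.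
Proof. by move=> az; apply: block_entry_eq0 => k m /az. Qed.

Lemma block_entry0r a b x i z w :
  (forall m, b i m <> w) -> block_entry a b x i z w = 0.
Proof. by move=> bw; apply: block_entry_eq0 => k m _ /bw. Qed.

Lemma block_comp_subproof a b x i s t :
  finite_set [set pq | block_entry a b x i (s, pq.1) (t, pq.2) <> 0 :> C].
Proof.
apply: (sub_finite_set _ (finite_image (fun km => ((a i km.1).2, (b i km.2).2))
  (fsvalP (x i)))) => -[p q] /= /block_entry_neq0[k [m [ak bm x0]]].
by exists (k, m) => //=; rewrite ak bm.
Qed.

(** The position ((s, p), (t, q)) of block [i] is split: (s, t) indexes the outer [T]-matrix, (p, q)
    the inner one. Finiteness of support is proved level by level. *)
Definition block_comp a b x s t i : fmatrix (S' i) C :=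
  FinSupp (block_comp_subproof a b x i s t).

Lemma block_row_subproof a b x s t :
  finite_set [set i | block_comp a b x s t i <> 0].
Proof.
apply: (sub_finite_set _ (fsvalP x)) => i /= + xi0; apply.
apply: finsuppP => pq /=; rewrite /block_entry xi0.
by case: partial_inv => // k; case: partial_inv.
Qed.

Definition block_row a b x s t : dirsum (fun i => fmatrix (S' i) C) :=
  FinSupp (block_row_subproof a b x s t).

(** Finitely many [i] contribute, each through the image of the finite support of [x i] under the
    [T]-coordinates of [a i] and [b i]. *)
Lemma block_subproof a b x :
  finite_set [set st | block_row a b x st.1 st.2 <> 0].
Proof.
pose F i := [set ((a i km.1).1, (b i km.2).1) | km in [set km | x i km <> 0]].
apply: (@sub_finite_set _ _ (\bigcup_(i in [set i | x i <> 0]) F i)); last first.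
  by apply: bigcup_finite => [|i _]; [exact: fsvalP|exact/finite_image/fsvalP].
move=> [s t] /= x0; apply: contrapT => nF; apply: x0.
apply: finsuppP => i; apply: finsuppP => -[p q]; apply: contrapT.
move=> /block_entry_neq0[k [m [ak bm xkm]]]; apply: nF; exists i.
  by move=> /= xi0; apply: xkm; rewrite xi0.
by exists (k, m) => //=; rewrite ak bm.
Qed.

Definition block a b x : fmatrix T (dirsum (fun i => fmatrix (S' i) C)) :=
  FinSupp (block_subproof a b x).

Lemma blockE a b x s t i p q :
  block a b x (s, t) i (p, q) = block_entry a b x i (s, p) (t, q).
Proof. by []. Qed.

Lemma block_linear a b : linear (block a b).
Proof.
move=> r x y; apply: finsuppP => -[s t]; apply: finsuppP => i; apply: finsuppP => -[p q].
rewrite !(fsDE, fsZE) !blockE /block_entry.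
by case: partial_inv => [k|]; [case: partial_inv => [m|]|]; rewrite ?scaler0 ?addr0.
Qed.

(** The outer product sums over [T] and the inner one over [S' i]; finite supports allow merging
    both into one sum over pairs. *)
Lemma block_mulE a b c d x y s t i p q :
  numul (block a b x) (block c d y) (s, t) i (p, q) =
  \sum_(z \in [set: T * S' i])
    numul (block_entry a b x i (s, p) z) (block_entry c d y i z (t, q)).
Proof.
have [U xU] := fmatrix_cols (block a b x).
have [V xV] := fmatrix_cols (x i).
(* [W] bounds the inner columns for all [u] at once, so that the double sum runs over a product of
   finite sets. *)
pose W := [fset (b i m).2 | m in V]%fset.
have xW u e : e \notin W -> block_entry a b x i (s, p) (u, e) = 0.
  apply: contraNP => /block_entry_neq0[k [m [ak bm xkm]]]; apply/imfsetP.
  by exists m; [apply: contra_notT xkm => /xV->|rewrite bm].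
rewrite (fmatrix_mulE _ _ (xU s)).
transitivity (\sum_(u <- U) (numul (block a b x (s, u) i) (block c d y (u, t) i)
    : fmatrix (S' i) C) (p, q)).
  by rewrite !fs_sumE.
transitivity (\sum_(u <- U) \sum_(e <- W)
    numul (block_entry a b x i (s, p) (u, e)) (block_entry c d y i (u, e) (t, q))).
  apply: eq_bigr => u _.
  by rewrite (@fmatrix_mulE _ _ _ (block a b x (s, u) i) _ p q W (xW u)).
rewrite fsbig_seq//.
under eq_fsbigr do rewrite fsbig_seq//.
rewrite pair_fsbig//; transitivity (\sum_(z \in [set` U] `*` [set` W])
    numul (block_entry a b x i (s, p) z) (block_entry c d y i z (t, q))).
  by apply: eq_fsbigr => -[].
apply: fsbig_widen => // -[u e] [_ /= UW].
have [uU|uU] := boolP (u \in U); last first.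
  by rewrite -(blockE a b x s u p e) (xU s u uU) numul0l.
rewrite xW ?numul0l//; apply/negP => eW; exact: UW.
Qed.

(** Here w u = 1 for the 0-1 matrices meeting in the middle: the sum is supported on the image of
    [b i], and injectivity reindexes it by [S i]. *)
Lemma block_mul a b c x y : (forall i, injective (a i)) -> (forall i, injective (b i)) ->
   (forall i, injective (c i)) ->
  numul (block a b x) (block b c y) = block a c (numul x y).
Proof.
move=> ai bi ci; apply: finsuppP => -[s t]; apply: finsuppP => i; apply: finsuppP => -[p q].
rewrite block_mulE blockE.
have [[k <-]|/forallNP ak] := pselect (exists k, a i k = (s, p)); last first.
  by rewrite block_entry0l// fsbig1// => z _; rewrite block_entry0l// numul0l.
have [[m <-]|/forallNP cm] := pselect (exists m, c i m = (t, q)); last first.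
  by rewrite block_entry0r// fsbig1// => z _; rewrite (block_entry0r _ _ _ cm) numul0r.
rewrite block_entryE//= /fmatrix_coef /=.
transitivity (\sum_(z \in b i @` [set: S i])
    numul (block_entry a b x i (a i k) z) (block_entry b c y i z (c i m))).
  apply/esym/fsbig_widen => // z [_ /= zb].
  by rewrite block_entry0r ?numul0l// => n bn; apply: zb; exists n.
rewrite fsbig_image => [|n n' _ _]; last exact: bi.
by apply: eq_fsbigr => n _; rewrite !block_entryE.
Qed.

(** Here w u = 0: no middle index lies in both images. *)
Lemma block_mul0 a b c d x y : (forall i k m, b i k <> c i m) ->
  numul (block a b x) (block c d y) = 0.
Proof.
move=> bc; apply: finsuppP => -[s t]; apply: finsuppP => i; apply: finsuppP => -[p q].
rewrite block_mulE; apply: fsbig1 => z _.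
have [[k <-]|/forallNP bk] := pselect (exists k, b i k = z).
  by rewrite (block_entry0l (a := c)) ?numul0r// => m /esym; exact: bc.
by rewrite block_entry0r// numul0l.
Qed.

End BlockMap.

(** * Isomorphisms in a category *)

Lemma is_iso_comp (D : category) (x y z : D) (g : hom y z) (f : hom x y) :
  is_iso g -> is_iso f -> is_iso (g ∘ f).
Proof.
move=> [g' [g'g gg']] [f' [f'f ff']]; exists (f' ∘ g'); split.
  by rewrite -compA (compA g') g'g comp1c.
by rewrite -compA (compA f) ff' comp1c.
Qed.

Lemma is_iso_fmor (D E : category) (F : functor D E) (x y : D) (f : hom x y) :
  is_iso f -> is_iso (fmor F f).
Proof. by move=> [g [gf fg]]; exists (fmor F g); rewrite -!fmorM gf fg !fmor1. Qed.

(** If [u] inverts [g ∘ f] and [w'] inverts [h ∘ g], then inserting [g ∘ f ∘ u = 1] gives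
    [w' ∘ h = f ∘ u], so [u ∘ g] is a two-sided inverse of [f]. *)
Lemma is_iso_two_of_six (D : category) (x y z w : D)
    (h : hom z w) (g : hom y z) (f : hom x y) :
  is_iso (g ∘ f) -> is_iso (h ∘ g) -> is_iso f.
Proof.
move=> [u [uK Ku]] [w' [wK _]].
have whE : w' ∘ h = f ∘ u.
  by rewrite -[LHS]compc1 -Ku -!compA (compA h) (compA w') wK comp1c.
exists (u ∘ g); split; first by rewrite -compA.
by rewrite compA -whE -compA.
Qed.

(** * Functoriality of matrix algebras, and matrices of size one *)

Section MatrixMap.
Variables (R : comPzRingType) (T : choiceType) (A B : nualgType R) (f : nuhom A B).

Lemma fmatrix_map_subproof (x : fmatrix T A) : finite_set [set st | f (x st) <> 0].
Proof. by apply: sub_finite_set (fsvalP x) => st /= + x0; rewrite x0 linear0. Qed.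

Definition fmatrix_map_fun (x : fmatrix T A) : fmatrix T B :=
  FinSupp (fmatrix_map_subproof x).

Lemma fmatrix_map_linear : linear fmatrix_map_fun.
Proof. by move=> a x y; apply: finsuppP => st /=; rewrite linearP. Qed.

Lemma fmatrix_mapM : {morph fmatrix_map_fun : x y / numul x y}.
Proof.
move=> x y; apply: finsuppP => -[s t]; have [U xU] := fmatrix_cols x.
rewrite (@fmatrix_mulE _ _ _ _ _ _ _ U) => [|u /xU xu]; last by rewrite /= xu linear0.
rewrite [LHS]/= -[fmatrix_coef _ _ _]/(numul x y (s, t)) (fmatrix_mulE _ _ (xU s)).
by rewrite linear_sum; apply: eq_bigr => u _; exact: nuhomM.
Qed.

Definition fmatrix_map : nuhom (fmatrix T A) (fmatrix T B) :=
  NuHom fmatrix_map_linear fmatrix_mapM.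
End MatrixMap.

Section UnitMatrix.
Variables (R : comPzRingType) (A : nualgType R).

Let entry_fun (x : fmatrix unit A) : A := x (tt, tt).

Lemma unit_entry_linear : linear entry_fun.
Proof. by []. Qed.

Lemma unit_entryM : {morph entry_fun : x y / numul x y}.
Proof.
move=> x y; rewrite /entry_fun (@fmatrix_mulE _ _ _ _ _ _ _ [fset tt]%fset) => [|[]].
  by rewrite big_seq_fset1.
by rewrite in_fset1.
Qed.

Definition unit_entry : nuhom (fmatrix unit A) A := NuHom unit_entry_linear unit_entryM.

Lemma unit_entryK x : corner A tt (unit_entry x) = x.
Proof. by apply: finsuppP => -[[] []]. Qed.
End UnitMatrix.

(** * Block homomorphisms up to homotopy, and corner inclusions *)

Section BlockHom.
Variables (R : comPzRingType) (C : nualgType R) (I : Type) (T : choiceType).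
Variables (S S' : I -> choiceType).
Implicit Types a b : forall i, S i -> T * S' i.

Lemma block_homM a : (forall i, injective (a i)) ->
  {morph @block R C I T S S' a a : x y / numul x y}.
Proof. by move=> ai x y; rewrite block_mul. Qed.

Definition block_hom a (ai : forall i, injective (a i)) :
    nuhom (dirsum (fun i => fmatrix (S i) C))
          (fmatrix T (dirsum (fun i => fmatrix (S' i) C))) :=
  NuHom (block_linear a a) (block_homM ai).

(** The maps [block (c j) (c k)], with [c] choosing between [a] and [b], satisfy the rotation
    relations: equal middle indices by [block_mul], distinct ones by [block_mul0]. *)
Lemma homotopy_invariant_block (D : tricat) (X : functor (Alg R) D) a b
    (ai : forall i, injective (a i)) (bi : forall i, injective (b i)) :
  (forall i k m, a i k <> b i m) -> homotopy_invariant X ->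
  fmor X (block_hom ai : @hom (Alg R) _ _) = fmor X (block_hom bi : @hom (Alg R) _ _).
Proof.
move=> ab Xh; pose c j := if j then b else a.
have ci j i : injective (c j i) by case: j; [exact: bi|exact: ai].
have cl j k : linear (@block R C _ _ _ _ (c j) (c k)) by exact: block_linear.
have cM j k m n x y : numul (@block R C _ _ _ _ (c j) (c k) x) (block (c m) (c n) y) =
    if k == m then block (c j) (c n) (numul x y) else 0.
  case: eqP => [<-|km]; first exact: block_mul.
  by apply: block_mul0 => i p q; case: k m km => -[] //= _ /esym; exact: ab.
have := homotopy_invariant_phi_diag cl cM Xh.
by congr (fmor X _ = fmor X _); exact: nuhomP.
Qed.

Definition corner_index (t : T) i (k : S i) : T * S i := (t, k).

End BlockHom.

Lemma corner_index_inj (I : Type) (T : choiceType) (S : I -> choiceType) (t : T) i :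
  injective (@corner_index I T S t i).
Proof. by move=> k m []. Qed.

(** Brings matrix stability to bear: a block homomorphism homotopic to this one becomes
    invertible. *)
Lemma block_hom_corner (R : comPzRingType) (C : nualgType R) (I : Type)
    (T : choiceType) (S : I -> choiceType) (t0 : T) :
  block_hom C (@corner_index_inj I T S t0) =
  corner (dirsum (fun i => fmatrix (S i) C)) t0.
Proof.
apply: nuhomP => x; apply: finsuppP => -[s t]; apply: finsuppP => i; apply: finsuppP => -[p q].
rewrite [LHS]blockE [RHS]/=; case: eqP => [[-> ->]|st].
  by rewrite -[(t0, p)]/(corner_index t0 p) -[(t0, q)]/(corner_index t0 q) block_entryE//;
    exact: corner_index_inj.
have [s0|s0] := eqVneq s t0.
  by rewrite block_entry0r// => m [t0t _]; apply: st; rewrite s0 -t0t.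
by rewrite block_entry0l// => k [/esym/eqP]; rewrite (negbTE s0).
Qed.

(** * Injections into the index set [T] *)

Lemma existT_inj2 (I : Type) (S : I -> Type) i : injective (existT S i).
Proof.
move=> k m e; have := projT2_eq e.
by rewrite (Prop_irrelevance (projT1_eq e) erefl).
Qed.

Lemma card_le_setT_inj (X Y : Type) :
  [set: X] #<= [set: Y] -> exists f : X -> Y, injective f.
Proof.
move=> /card_leP/unsquash e; exists (fun x => \val (e (to_setT x))) => x y /val_inj exy.
have /(congr1 \val)// : to_setT x = to_setT y.
by apply: (@inj _ _ _ e) exy; rewrite inE.
Qed.

(** Hilbert's hotel: along an embedded copy [e] of the natural numbers, [e n] moves to [e n.+1],
    which frees [e 0]; all other points stay. *)
Lemma infinite_shift (T : choiceType) : infinite_set [set: T] ->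
  exists (f : T -> T) t0, injective f /\ forall t, f t <> t0.
Proof.
move=> /infiniteP/card_le_setT_inj[e ei].
pose f t := if partial_inv e t is Some n then e n.+1 else t.
exists f, (e 0%N); split=> [t u|t]; rewrite /f.
  case Et: partial_inv => [n|]; case Eu: partial_inv => [m|] //.
  - move=> /ei[nm]; rewrite nm in Et.
    by rewrite -(partial_inv_some Et) -(partial_inv_some Eu).
  - by move=> enu; rewrite -enu partial_invK in Eu.
  - by move=> etm; rewrite etm partial_invK in Et.
case Et: partial_inv => [n|]; first by move=> /ei.
by move=> et; rewrite et partial_invK in Et.
Qed.

Theorem proposition3p12 (l : comPzRingType) (I : Type) (S_ : I -> choiceType)
    (v : forall i, S_ i) (T : choiceType) (kk : tricat)
    (j : homology_theory l kk) :
  infinite_set [set: T] ->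
  [set: {i : I & S_ i}] #<= [set: T] ->
  universal_theory T j ->
  is_iso (fmor j (dirsum_map (fun i : I => corner (l^o : nualgType l) (v i)))).
Proof.
move=> Tinf /card_le_setT_inj[e ei] [[_ jh jT] _].
have [sh [t0 [sh_inj sh_t0]]] := infinite_shift Tinf.
pose tau i (k : S_ i) := sh (e (existT _ i k)).
have tau_inj i : injective (tau i) by move=> k m /sh_inj/ei; exact: existT_inj2.
have tau_t0 i k : tau i k <> t0 by exact: sh_t0.
(* Writing l as M_1 l makes source and target direct sums of matrix algebras, the form that block
   maps require. *)
pose U (_ : I) : choiceType := unit.
pose f := dirsum_map (fun i : I => corner (l^o : nualgType l) (v i)).
pose f1 := dirsum_map (fun i : I => corner (l^o : nualgType l) tt).
pose a i k : T * U i := (tau i k, tt).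
have ai i : injective (a i) by move=> k m [/tau_inj].
pose b i (k : U i) : T * U i := (tau i (v i), k).
have bi i : injective (b i) by move=> k m [].
pose c i (k : S_ i) : T * S_ i := (tau i k, v i).
have ci i : injective (c i) by move=> k m [/tau_inj].
pose g := block_hom (l^o : nualgType l) ai.
pose h := fmatrix_map T (dirsum_map (fun i : I =>
   nuhom_comp (corner (l^o : nualgType l) (v i)) (unit_entry (l^o : nualgType l)))).
(* In block [i], [f] fills only the entry (v_i, v_i), which [g] moves to the [T]-position given by
   [tau i (v i)]; this is what [b] encodes. *)
have gfE : nuhom_comp g f = nuhom_comp (block_hom _ bi) f1.
  apply: nuhomP => x; apply: finsuppP => -[s t]; apply: finsuppP => i.
  apply: finsuppP => -[p q]; rewrite [LHS]blockE [RHS]blockE.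
  have [[<- <-]|st] := pselect ((tau i (v i), tau i (v i)) = (s, t)).
    case: p q => -[]; rewrite -[(_, tt)]/(a i (v i)) block_entryE//.
    rewrite -[a i (v i)]/(b i tt) block_entryE; [|exact: bi|exact: bi].
    by rewrite /= eqxx.
  rewrite !block_entry_eq0// => k m [ks _] [mt _]; first by case: st; rewrite -ks -mt.
  by rewrite /=; case: eqP => // -[kv mv]; case: st; rewrite -ks -mt kv mv.
(* [g] spreads the entries over [T], then [h] puts each at the inner position (v_i, v_i), the second
   coordinate of [c]. *)
have hgE : nuhom_comp h g = block_hom _ ci.
  apply: nuhomP => x; apply: finsuppP => -[s t]; apply: finsuppP => i.
  apply: finsuppP => -[p q]; rewrite [RHS]blockE [LHS]/=.
  have [[-> ->]|pq] := eqVneq (p, q) (v i, v i); last first.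
    rewrite block_entry_eq0// => k m [_ pv] [_ qv].
    by move/eqP: pq; rewrite -pv -qv.
  have [[k <-]|/forallNP sk] := pselect (exists k, tau i k = s); last first.
    by rewrite !block_entry0l// => k [/sk].
  have [[m <-]|/forallNP tm] := pselect (exists m, tau i m = t); last first.
    by rewrite !block_entry0r// => m [/tm].
  rewrite -[(tau i k, tt)]/(a i k) -[(tau i m, tt)]/(a i m) block_entryE//.
  by rewrite -[(tau i k, v i)]/(c i k) -[(tau i m, v i)]/(c i m) block_entryE.
have f1_iso : @is_iso (Alg l) _ _ f1.
  exists (dirsum_map (fun i : I => unit_entry (l^o : nualgType l))).
  split; apply: nuhomP => x; apply: finsuppP => i //=.
  exact: unit_entryK.
apply: (@is_iso_two_of_six kk _ _ _ _
  (fmor j (h : @hom (Alg l) _ _)) (fmor j (g : @hom (Alg l) _ _))).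
  rewrite -(fmorM j) [X in fmor j X]gfE (fmorM j).
  apply: is_iso_comp; last exact: is_iso_fmor.
  (* Since [tau] misses [t0], the map of [b] may be replaced by the corner inclusion at [t0], which
     [j] inverts; likewise for [c] below. *)
  rewrite -(homotopy_invariant_block _ (@corner_index_inj _ _ _ t0) bi) ?block_hom_corner//.
  by move=> i k m [/esym/tau_t0].
rewrite -(fmorM j) [X in fmor j X]hgE.
rewrite -(homotopy_invariant_block _ (@corner_index_inj _ _ _ t0) ci) ?block_hom_corner//.
by move=> i k m [/esym/tau_t0].
Qed.
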